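(* Let $H$ be a complex Hilbert space with $\dim H\ge 3$ (possibly infinite-dimensional). Then every automorphism $f$ of the logic $\mathcal{L}(H)$ is induced by a unitary or anti-unitary operator $U$ on $H$, i.e. $f(X)=U(X)$ for every $X\in\mathcal{L}(H)$. This operator is unique up to a unit scalar multiple, i.e. up to multiplication by a complex number $a$ with $|a|=1$.
   Context: $\mathcal{L}(H)$ is the lattice of all closed subspaces of $H$ ordered by inclusion, together with the orthogonal complementation $X\mapsto X^{\perp}$. An automorphism of the logic $\mathcal{L}(H)$ is a bijection $f:\mathcal{L}(H)\to\mathcal{L}(H)$ with $X\subset Y\Leftrightarrow f(X)\subset f(Y)$ for all $X,Y$ and $f(X^{\perp})=f(X)^{\perp}$ for all $X$. A unitary operator is an invertible linear operator $U$ on $H$ with $\langle U(x),U(y)\rangle=\langle x,y\rangle$ for all $x,y\in H$; an anti-unitary operator is an invertible conjugate-linear operator $U$ on $H$ with $\langle U(x),U(y)\rangle=\overline{\langle x,y\rangle}$ for all $x,y\in H$. *)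

(* Defs.v *)
From HB Require Import structures.
From mathcomp Require Import all_boot all_order all_algebra complex ring.
From mathcomp Require Import all_classical all_reals all_analysis.

Set Implicit Arguments.
Unset Strict Implicit.
Unset Printing Implicit Defensive.

Import Order.TTheory GRing.Theory Num.Theory.
Import numFieldNormedType.Exports.

Local Open Scope ring_scope.
Local Open Scope classical_set_scope.

(* A Hilbert space is a complete normed space over R[i] whose norm comes from
   an inner product, linear in its first argument and conjugate-linear in its
   second.  The norm of a normed R[i]-module takes its values in R[i]. *)
HB.mixin Record isComplexHilbert (R : realType) (H : Type)
    of CompleteNormedModule R[i] H := {
  inner : {dot H for @Num.conj R[i]} ;
  sqr_norm_inner : forall x : H, `|x| ^+ 2 = inner x x
}.

#[short(type="complexHilbertType")]
HB.structure Definition ComplexHilbert (R : realType) :=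
  { H of isComplexHilbert R H & CompleteNormedModule R[i] H }.

(* dim H >= n, for a space that may be infinite-dimensional: H contains n
   linearly independent vectors (`free` and `\dim` need a finite-dimensional
   vectType). *)
Definition dim_ge (K : fieldType) (V : lmodType K) (n : nat) : Prop :=
  exists e : 'I_n -> V, forall c : 'I_n -> K,
    \sum_(i < n) c i *: e i = 0 -> forall i, c i = 0.

Record closed_subspace (R : realType) (H : complexHilbertType R) :=
  ClosedSubspace {
    subspace_set :> set H ;
    subspace_submod : submod_closed [in subspace_set] ;
    subspace_closed : closed subspace_set
  }.

Section Orthocomplement.
Variables (R : realType) (H : complexHilbertType R).

Definition orthoset (X : set H) : set H :=
  [set y | forall x, X x -> inner x y = 0].

Lemma CauchySchwarz_inner (x y : H) : `|inner x y| <= `|x| * `|y|.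
Proof.
have [->|y0] := eqVneq y 0; first by rewrite linear0r !normr0 mulr0.
rewrite -(@ler_pXn2r _ 2)// ?nnegrE ?mulr_ge0//.
rewrite exprMn !sqr_norm_inner normCK.
have D0 : 0 < inner y y by exact: neq0_dnorm_gt0.
have DK : (inner y y)^* = inner y y.
  by rewrite -sqr_norm_inner rmorphXn/= geC0_conj.
set D := inner y y in D0 DK *; set a := inner x y.
have aE : inner y x = a^*.
  by rewrite (@hermitian_subproof _ _ _ _ inner)/= expr0 mul1r.
have : 0 <= inner (D *: x - a *: y) (D *: x - a *: y).
  by rewrite -sqr_norm_inner exprn_ge0.
rewrite linearBr/= !linearBl/= !linearZr_LR/= !linearZl_LR/= aE -/a -/D DK.
rewrite (_ : _ - _ = D * (inner x x * D - a * a^*)); last by ring.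
by rewrite pmulr_rge0// subr_ge0.
Qed.

Lemma orthoset_submod (X : set H) : submod_closed [in orthoset X].
Proof.
split; first by rewrite inE => x _; rewrite linear0r.
move=> a u v; rewrite !inE => uX vX x Xx.
by rewrite linearPr/= uX// vX// mulr0 addr0.
Qed.

Lemma orthoset_closed (X : set H) : closed (orthoset X).
Proof.
move=> y /= clXy x Xx.
apply/eqP; rewrite -normr_le0; apply/ler_addgt0Pl => e e0; rewrite addr0.
have x1 : 0 < `|x| + 1 by rewrite ltr_wpDl.
have [|z [Xz]] := clXy (ball y (e / (`|x| + 1))).
  by apply: nbhsx_ballx; rewrite divr_gt0.
rewrite -ball_normE/= => yz.
rewrite (_ : inner x y = inner x (y - z)); last first.
  by rewrite linearBr/= Xz// subr0.
rewrite (le_trans (CauchySchwarz_inner _ _))//.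
rewrite (le_trans (ler_wpM2l _ (ltW yz)))//.
by rewrite mulrCA ger_pMr// ler_pdivrMr// mul1r lerDl.
Qed.

Definition orthocompl (X : closed_subspace H) : closed_subspace H :=
  ClosedSubspace (orthoset_submod X) (@orthoset_closed X).

End Orthocomplement.

Definition logic_automorphism (R : realType) (H : complexHilbertType R)
    (f : closed_subspace H -> closed_subspace H) : Prop :=
  [/\ bijective f,
      forall X Y : closed_subspace H, X `<=` Y <-> f X `<=` f Y
    & forall X : closed_subspace H, f (orthocompl X) = orthocompl (f X)].

Definition unitary (R : realType) (H : complexHilbertType R) (U : H -> H) : Prop :=
  [/\ bijective U, linear U & forall x y, inner (U x) (U y) = inner x y].

Definition antiunitary (R : realType) (H : complexHilbertType R)
    (U : H -> H) : Prop :=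
  [/\ bijective U, linear_for (@Num.conj R[i] \; *:%R) U
    & forall x y, inner (U x) (U y) = (inner x y)^*].

Definition induced_by (R : realType) (H : complexHilbertType R)
    (f : closed_subspace H -> closed_subspace H) (U : H -> H) : Prop :=
  (unitary U \/ antiunitary U) /\
  forall X : closed_subspace H, subspace_set (f X) = U @` X.

(* Main.v *)
Require Import Defs.
From HB Require Import structures.
From mathcomp Require Import all_boot all_order all_algebra complex.
From mathcomp Require Import all_classical all_reals all_analysis.

(** The theorem is a form of Wigner's theorem due to Uhlhorn, and the proof
    coordinatizes the automorphism directly, with orthogonality doing the work
    that is usually left to the fundamental theorem of projective geometry.

    The atoms of the lattice are the lines, and a closed subspace is the union
    of its lines, so [f] is determined by the relation [M x v] which says that
    [v] lies in the image of the line of [x].  Order and complement translate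
    into properties of [M] ([line_correspondence]): it is a bijection between
    lines, it preserves orthogonality, and it preserves coplanarity because a
    plane is a closed subspace, hence the image of one.

    Fix unit vectors [e] and [e'] with [M e e'].  For [y] orthogonal to [e], the
    line of [e + y] is sent to a line which is not orthogonal to [e'] and which
    therefore contains exactly one vector of the form [e' + S y] ([S] is [shift]
    below).  This chart of the projective space linearizes [M]: the line of [e + y + z] is the
    intersection of the planes of [e + y], [z] and of [e + z], [y], which gives
    [S (y + z) = S y + S z] for independent [y] and [z].  Since [e] has at least
    two independent directions orthogonal to it, the factor by which [S] rescales
    a multiple of [y] does not depend on [y]: [S (a *: y) = sg a *: S y] with [sg]
    (it is [scalar_map]) a ring endomorphism of the complex numbers.

    No continuity is known so far, and the complex numbers have many wild
    endomorphisms.  Orthogonality excludes them: [e + y] is orthogonal to [e + z]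
    exactly when [inner y z = -1], so [S] preserves the value [-1] of the inner
    product.  By homogeneity this forces [sg] to commute with conjugation, and
    [S] to transform all inner products by [sg].  An endomorphism that commutes
    with conjugation maps [r = t * t^*] to a number of the same form, so it is
    monotone on the reals, hence the identity there, hence the identity or the
    conjugation ([conj_endoP]).  Extending [S] by [e |-> e'] gives [U].

    If [V] is another solution, then [V x] is a multiple of [U x] for each [x],
    with the same factor for orthogonal nonzero [x] and [y], as one sees on
    [x + y]; in dimension at least 3 any two vectors have a common nonzero
    orthogonal vector, so the factor is constant, and it has modulus 1 because
    [U] and [V] preserve the norm. *)

Set Implicit Arguments.
Unset Strict Implicit.
Unset Printing Implicit Defensive.

Import Order.TTheory GRing.Theory Num.Theory.
Import numFieldNormedType.Exports.

Local Open Scope ring_scope.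

(** * Endomorphisms of the complex field that commute with conjugation *)

Section ComplexEndomorphisms.
Context {R : realType}.
Variable s : {rmorphism R[i] -> R[i]}.
Hypothesis s_conj : forall a, s a^* = (s a)^*.

(** A nonnegative number is [t * t^*] with [t] real, a form which [s] preserves. *)
Lemma conj_endo_ge0 (a : R[i]) : 0 <= a -> 0 <= s a.
Proof.
move=> a0; rewrite -(sqrtCK a) rmorphXn/= expr2.
have {2}-> : s (sqrtC a) = (s (sqrtC a))^*.
  by rewrite -s_conj geC0_conj// sqrtC_ge0.
exact: mul_conjC_ge0.
Qed.

(** [s] is monotone on the reals and fixes the rationals, which are dense. *)
Lemma conj_endo_real (x : R) : s x%:C%C = x%:C%C.
Proof.
have [y sy] : exists y : R, s x%:C%C = y%:C%C.
  apply/complex_realP/CrealP; rewrite -s_conj; congr (s _).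
  by apply/CrealP/complex_realP; exists x.
have ratrC (q : rat) : (ratr q : R)%:C%C = ratr q.
  exact: (fmorph_rat (real_complex R)).
have s_le (q : rat) : x <= ratr q -> y <= ratr q.
  move=> xq; rewrite -lecR -sy ratrC -(fmorph_rat s) -subr_ge0 -rmorphB.
  by apply: conj_endo_ge0; rewrite subr_ge0 -ratrC lecR.
have s_ge (q : rat) : ratr q <= x -> ratr q <= y.
  move=> xq; rewrite -lecR -sy ratrC -(fmorph_rat s) -subr_ge0 -rmorphB.
  by apply: conj_endo_ge0; rewrite subr_ge0 -ratrC lecR.
rewrite sy; congr (_%:C)%C.
have [xy|yx|//] := ltgtP x y.
- have [q] := rat_in_itvoo xy; rewrite in_itv/= => /andP[/ltW xq qy].
  by have := s_le _ xq; rewrite leNgt qy.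
- have [q] := rat_in_itvoo yx; rewrite in_itv/= => /andP[yq /ltW qx].
  by have := s_ge _ qx; rewrite leNgt yq.
Qed.

(** The two cases are the two square roots of [-1] to which ['i] can go. *)
Lemma conj_endoP : (forall a, s a = a) \/ (forall a, s a = a^*).
Proof.
have sR (a : R[i]) : a \is Num.real -> s a = a.
  by move=> /complex_realP[x ->]; exact: conj_endo_real.
have sE (a : R[i]) : s a = 'Re a + s 'i * 'Im a.
  by rewrite {1}[a]Crect rmorphD rmorphM (sR _ (Creal_Re a)) (sR _ (Creal_Im a)).
have : s 'i ^+ 2 == 'i ^+ 2.
  by rewrite -rmorphXn/= sqrCi rmorphN1.
rewrite eqf_sqr => /orP[]/eqP si; [left|right] => a.
  by rewrite sE si -Crect.
by rewrite sE si [in RHS](Crect a) conjC_rect ?Creal_Re ?Creal_Im// mulNr.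
Qed.

End ComplexEndomorphisms.

(** * Inner products, lines and planes *)

Section InnerProduct.
Context {R : realType} {H : complexHilbertType R}.
Implicit Types (x y z : H) (a : R[i]).

Lemma innerDl x y z : inner (x + y) z = inner x z + inner y z.
Proof. exact: linearDl. Qed.

Lemma innerDr x y z : inner z (x + y) = inner z x + inner z y.
Proof. exact: linearDr. Qed.

Lemma innerBl x y z : inner (x - y) z = inner x z - inner y z.
Proof. by rewrite linearBl. Qed.

Lemma innerZl a x y : inner (a *: x) y = a * inner x y.
Proof. by rewrite linearZl_LR. Qed.

Lemma innerZr a x y : inner x (a *: y) = a^* * inner x y.
Proof. by rewrite linearZr_LR. Qed.

Lemma inner0l x : inner 0 x = 0.
Proof. by rewrite linear0l. Qed.

Lemma inner0r x : inner x 0 = 0.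
Proof. by rewrite linear0r. Qed.

Lemma inner_conj x y : inner x y = (inner y x)^*.
Proof. by rewrite (@hermitian_subproof _ _ _ _ inner)/= expr0 mul1r. Qed.

Lemma inner_eq0C x y : inner x y = 0 -> inner y x = 0.
Proof. by move=> xy; rewrite inner_conj xy conjC0. Qed.

Lemma inner_eq0 x : inner x x = 0 -> x = 0.
Proof. by move/eqP; rewrite dnorm_eq0 => /eqP. Qed.

Lemma inner_neq0 x : x <> 0 -> inner x x != 0.
Proof. by move=> x0; apply/eqP => /inner_eq0. Qed.

Lemma unit_neq0 x : inner x x = 1 -> x <> 0.
Proof.
by move=> x1 x0; move: x1; rewrite x0 inner0l => /eqP; rewrite eq_sym oner_eq0.
Qed.

Lemma exists_unit_multiple x : x <> 0 ->
  exists2 a, a != 0 & inner (a *: x) (a *: x) = 1.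
Proof.
move=> /eqP x0; exists `|x|^-1; first by rewrite invr_eq0 normr_eq0.
rewrite innerZl innerZr -sqr_norm_inner geC0_conj ?invr_ge0//.
by rewrite mulrA -expr2 exprVn mulVf// expf_eq0/= normr_eq0.
Qed.

(** Orthogonality to [x] and [y] puts 2 linear conditions on the 3 coefficients of
    a combination of the given independent vectors.  This is the only form in
    which the dimension of [H] enters. *)
Lemma exists_orthogonal x y : dim_ge H 3 ->
  exists2 w : H, w <> 0 & inner w x = 0 /\ inner w y = 0.
Proof.
move=> [e e_free].
pose A := \matrix_(i < 3, j < 2) inner (e i) (if j == 0 then x else y).
have : kermx A != 0.
  rewrite kermx_eq0 /row_free; apply/eqP => rA.
  by have := rank_leq_col A; rewrite rA.
case/rowV0Pn => c /sub_kermxP cA c0.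
have wE z : inner (\sum_(i < 3) c 0 i *: e i) z =
    \sum_(i < 3) c 0 i * inner (e i) z.
  by rewrite linear_sumlz/=; apply: eq_bigr => i _; rewrite innerZl.
exists (\sum_(i < 3) c 0 i *: e i).
  move=> /e_free c00; move/eqP: c0; apply; apply/rowP => i.
  by rewrite c00 mxE.
have cAE j :
    \sum_(i < 3) c 0 i * inner (e i) (if j == 0 :> 'I_2 then x else y) = 0.
  move: cA => /rowP/(_ j); rewrite !mxE => cA; rewrite -[RHS]cA.
  by apply: eq_bigr => i _; rewrite mxE.
by rewrite !wE; split; [exact: (cAE 0)|exact: (cAE 1)].
Qed.

(** Lines and planes are defined as double orthogonals, which are closed for free;
    that they are the linear spans follows by orthogonal projection, without
    any appeal to completeness. *)
Definition biorth (A : set H) : closed_subspace H :=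
  ClosedSubspace (orthoset_submod (orthoset A))
    (@orthoset_closed _ _ (orthoset A)).

Definition line x : closed_subspace H := biorth [set x].
Definition plane x y : closed_subspace H := biorth [set x; y].

(** The value at [x = 0] is [0], the right one, since [0^-1 = 0]. *)
Definition proj x z := (inner z x / inner x x) *: x.

Lemma proj_orth x z : inner (z - proj x z) x = 0.
Proof.
rewrite innerBl innerZl; have [->|/eqP/inner_neq0 x0] := eqVneq x 0.
  by rewrite !inner0r mulr0 subr0.
by rewrite divfK ?subrr.
Qed.

Lemma subspaceD (X : closed_subspace H) x y :
  subspace_set X x -> subspace_set X y -> subspace_set X (x + y).
Proof.
move=> Xx Xy; have [_ /(_ 1 x y)] := subspace_submod X.
by rewrite scale1r !inE; apply.
Qed.

Lemma subspace0 (X : closed_subspace H) : subspace_set X 0.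
Proof. by have [+ _] := subspace_submod X; rewrite inE. Qed.

Lemma subspaceZ (X : closed_subspace H) a x :
  subspace_set X x -> subspace_set X (a *: x).
Proof.
move=> Xx; have [_ /(_ a x 0)] := subspace_submod X.
rewrite addr0 !inE; apply => //; exact: subspace0.
Qed.

Lemma subspaceB (X : closed_subspace H) x y :
  subspace_set X x -> subspace_set X y -> subspace_set X (x - y).
Proof. by move=> Xx Xy; rewrite -scaleN1r; apply: subspaceD => //; exact: subspaceZ. Qed.

Lemma biorth_sub (A : set H) x : A x -> subspace_set (biorth A) x.
Proof. by move=> Ax y /(_ _ Ax) /inner_eq0C. Qed.

Lemma line_self x : subspace_set (line x) x. Proof. exact: biorth_sub. Qed.

(** The component of [z] orthogonal to [x] and to [y], found by the Gram-Schmidt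
    process, lies in the double orthogonal and in the orthogonal, so it is 0. *)
Lemma planeE x y z :
  subspace_set (plane x y) z -> exists a b, z = a *: x + b *: y.
Proof.
move=> Pz; pose y' := y - proj x y.
pose z1 := z - proj x z; pose z' := z1 - proj y' z1.
have Px : subspace_set (plane x y) x by apply: biorth_sub; left.
have Py : subspace_set (plane x y) y by apply: biorth_sub; right.
have Py' : subspace_set (plane x y) y' by apply: subspaceB => //; apply: subspaceZ.
have Pz' : subspace_set (plane x y) z'.
  by apply: subspaceB; [apply: subspaceB|apply: subspaceZ] => //; apply: subspaceZ.
have z'y' : inner z' y' = 0 by exact: proj_orth.
have z'x : inner z' x = 0.
  by rewrite innerBl proj_orth innerZl proj_orth mulr0 subrr.
have z'y : inner z' y = 0.
  by rewrite -(subrK (proj x y) y) innerDr z'y' add0r innerZr z'x mulr0.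
have z'0 : z' = 0.
  apply: inner_eq0; apply: Pz' => t /= [->|->]; exact: inner_eq0C.
have zE : z = proj x z + proj y' z1.
  by move/eqP: z'0; rewrite subr_eq0 => /eqP <-; rewrite addrC subrK.
rewrite zE /proj /y' /proj; set c := inner z1 _ / _; set d := inner z x / _.
exists (d - c * (inner y x / inner x x)), c.
by rewrite scalerBr scalerBl scalerA addrA addrAC.
Qed.

Lemma lineP x z : subspace_set (line x) z <-> exists a, z = a *: x.
Proof.
split => [|[a ->]]; last by apply: subspaceZ; exact: line_self.
move=> Lz; have : subspace_set (plane x x) z.
  by move=> t tx; apply: Lz => u /= ->; apply: tx; left.
by move=> /planeE[a [b ->]]; exists (a + b); rewrite scalerDl.
Qed.

Lemma line_subset (X : closed_subspace H) x :
  subspace_set X x -> (line x `<=` X)%classic.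
Proof. by move=> Xx z /lineP[a ->]; exact: subspaceZ. Qed.

End InnerProduct.

(** * The correspondence of lines induced by an automorphism *)

(** [M x v] is to be read as: the vector [v] lies on the line that corresponds to
    the line of [x].  A relation between vectors avoids the choice of a vector on
    each line. *)
Record line_correspondence {R : realType} {H : complexHilbertType R}
    (M : H -> H -> Prop) : Prop := LineCorrespondence {
  corr0 : forall x, M x 0;
  corrZ : forall a x v, M x v -> M x (a *: v);
  corr_scale : forall a x v, M (a *: x) v -> M x v;
  corr_neq0 : forall x, x <> 0 -> exists2 v, v <> 0 & M x v;
  corr_dim1 : forall x v w, M x v -> M x w -> v <> 0 -> exists a, w = a *: v;
  corr_orth : forall x y v w, inner x y = 0 -> M x v -> M y w -> inner v w = 0;
  corr_plane : forall x y v w a b t, M x v -> M y w -> v <> 0 -> w <> 0 ->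
    M (a *: x + b *: y) t -> exists c d, t = c *: v + d *: w;
  corr_inj : forall x y v, M x v -> M y v -> v <> 0 -> exists a, y = a *: x;
  corr_surj : forall v, exists x, M x v
}.

Section LinesOfAutomorphism.
Context {R : realType} {H : complexHilbertType R}.
Variables (f : closed_subspace H -> closed_subspace H).
Hypothesis hf : logic_automorphism f.

Definition image_line (x v : H) : Prop := subspace_set (f (line x)) v.

Local Lemma f_mono (X Y : closed_subspace H) :
  (X `<=` Y)%classic -> (f X `<=` f Y)%classic.
Proof. by have [_ /(_ X Y)[]] := hf. Qed.

Local Lemma f_reflect (X Y : closed_subspace H) :
  (f X `<=` f Y)%classic -> (X `<=` Y)%classic.
Proof. by have [_ /(_ X Y)[]] := hf. Qed.

Local Lemma f_surj (Y : closed_subspace H) : exists X, f X = Y.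
Proof. by have [[g _ gK] _ _] := hf; exists (g Y). Qed.

(** Both this lemma and the next express that [f] preserves the zero subspace. *)
Lemma image_line0 x v : image_line x v -> x = 0 -> v = 0.
Proof.
move=> Mv x0; have [Z fZ] := f_surj (line 0).
have /f_mono/(_ _ Mv) : (line x `<=` Z)%classic.
  by rewrite x0; apply: line_subset; exact: subspace0.
by rewrite fZ => /lineP[a ->]; rewrite scaler0.
Qed.

Lemma preimage_neq0 (X : closed_subspace H) v : subspace_set (f X) v -> v <> 0 ->
  exists2 x, x <> 0 & subspace_set X x.
Proof.
move=> Xv v0; apply: contrapT => noX; apply: v0; apply: (@image_line0 0) => //.
have /f_mono : (X `<=` line 0)%classic; last exact.
move=> x Xx; have [->|/eqP x0] := eqVneq x 0; first exact: subspace0.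
by case: noX; exists x.
Qed.

(** Lines are atoms: the line of [v] is the image of a nonzero subspace of the line
    of [x], hence of that line. *)
Lemma image_line_sub x v w : image_line x v -> v <> 0 -> image_line x w ->
  subspace_set (line v) w.
Proof.
move=> Mv v0 Mw; have [Y fY] := f_surj (line v).
have [y y0 Yy] : exists2 y, y <> 0 & subspace_set Y y.
  by apply: (@preimage_neq0 _ v) => //; rewrite fY; exact: line_self.
have /f_reflect YL : (f Y `<=` f (line x))%classic.
  by rewrite fY; exact: line_subset.
have [a ya] : exists a, y = a *: x by apply/lineP; exact: YL.
have a0 : a != 0 by apply/eqP => a0; apply: y0; rewrite ya a0 scale0r.
have Yx : subspace_set Y x.
  by rewrite -(scalerK a0 x) -ya; exact: subspaceZ.
by rewrite -fY; have /f_mono := line_subset Yx; apply.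
Qed.

Lemma image_line_in (X : closed_subspace H) x v : image_line x v -> v <> 0 ->
  subspace_set (f X) v -> subspace_set X x.
Proof.
move=> Mv v0 Xv; have /f_reflect : (f (line x) `<=` f X)%classic.
  by move=> w Mw; apply: (line_subset Xv); exact: image_line_sub Mw.
by apply; exact: line_self.
Qed.

Lemma image_line_mem (X : closed_subspace H) x v : image_line x v ->
  subspace_set X x -> subspace_set (f X) v.
Proof. by move=> Mv /line_subset/f_mono; apply. Qed.

Lemma image_line_neq0 x : x <> 0 -> exists2 v, v <> 0 & image_line x v.
Proof.
move=> x0; apply: contrapT => nov; apply: x0.
have [a ->] : exists a, x = a *: 0; last by rewrite scaler0.
apply/lineP; have /f_reflect : (f (line x) `<=` f (line 0))%classic.
  move=> v Mv; have [->|/eqP v0] := eqVneq v 0; first exact: subspace0.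
  by case: nov; exists v.
by apply; exact: line_self.
Qed.

Lemma image_line_correspondence : line_correspondence image_line.
Proof.
split.
- by move=> x; exact: subspace0.
- by move=> a x v; exact: subspaceZ.
- move=> a x v /image_line_mem; apply; apply: subspaceZ; exact: line_self.
- exact: image_line_neq0.
- by move=> x v w Mv Mw v0; apply/lineP; exact: image_line_sub Mw.
- move=> x y v w xy Mv Mw.
  have /f_mono : (line y `<=` orthocompl (line x))%classic.
    by apply: line_subset => z /lineP[a ->]; rewrite innerZl xy mulr0.
  have [_ _ ->] := hf.
  by move=> /(_ _ Mw); apply.
(* The plane of [v] and [w] is the image of a subspace containing [x], [y]. *)
- move=> x y v w a b t Mv Mw v0 w0 Mt; apply: planeE.
  have [Y fY] := f_surj (plane v w); rewrite -fY.
  apply: image_line_mem Mt _.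
  apply: subspaceD; apply: subspaceZ.
    by apply: image_line_in Mv v0 _; rewrite fY; apply: biorth_sub; left.
  by apply: image_line_in Mw w0 _; rewrite fY; apply: biorth_sub; right.
- by move=> x y v Mx My v0; apply/lineP; exact: image_line_in My v0 Mx.
- move=> v; have [->|/eqP v0] := eqVneq v 0; first by exists 0; exact: subspace0.
  have [X fX] := f_surj (line v).
  have [x x0 Xx] : exists2 x, x <> 0 & subspace_set X x.
    by apply: (@preimage_neq0 _ v) => //; rewrite fX; exact: line_self.
  exists x; have [w w0 Mw] := image_line_neq0 x0.
  have : subspace_set (f X) w by exact: image_line_mem Mw Xx.
  rewrite fX => /lineP[a wE].
  have a0 : a != 0 by apply/eqP => a0; apply: w0; rewrite wE a0 scale0r.
  by rewrite -(scalerK a0 v) -wE; exact: subspaceZ.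
Qed.
End LinesOfAutomorphism.

(** * Linear independence of two vectors *)

Section Independence.
Context {K : fieldType} {V : lmodType K}.
Implicit Types (x y z : V) (a b : K).

Definition indep x y := forall a b, a *: x + b *: y = 0 -> a = 0 /\ b = 0.

Lemma indepC x y : indep x y -> indep y x.
Proof. by move=> xy a b; rewrite addrC => /xy[]. Qed.

Lemma indepZ a b x y : a != 0 -> b != 0 -> indep x y -> indep (a *: x) (b *: y).
Proof.
move=> a0 b0 xy c d; rewrite !scalerA => /xy[/eqP + /eqP].
by rewrite !mulf_eq0 (negPf a0) (negPf b0) !orbF => /eqP -> /eqP ->.
Qed.

Lemma indep_neq0 x y : indep x y -> x <> 0.
Proof.
move=> xy x0; have [] := xy 1 0; first by rewrite x0 scaler0 scale0r addr0.
by move/eqP; rewrite oner_eq0.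
Qed.

Lemma indepN x y a : indep x y -> y <> a *: x.
Proof.
move=> xy yx; have [|_ /eqP] := xy (- a) 1; last by rewrite oner_eq0.
by rewrite scale1r yx scaleNr addNr.
Qed.

Lemma indepP x y : x <> 0 -> indep x y \/ exists a, y = a *: x.
Proof.
move=> x0; have [|nyx] := pselect (exists a, y = a *: x); [by right|left].
move=> a b ab0; have [b0|b0] := eqVneq b 0.
  move: ab0; rewrite b0 scale0r addr0 => /eqP; rewrite scaler_eq0.
  by case/orP => /eqP.
case: nyx; exists (- (b^-1 * a)); apply: (scalerI b0).
rewrite scalerA mulrN mulVKf// scaleNr; apply/eqP.
by rewrite -addr_eq0 addrC ab0.
Qed.

Lemma indep_coef x y a b c d : indep x y ->
  a *: x + b *: y = c *: x + d *: y -> a = c /\ b = d.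
Proof.
move=> xy /eqP; rewrite -subr_eq0 opprD addrACA -!scalerBl => /eqP/xy[].
by split; apply: subr0_eq.
Qed.

Lemma indep_shear x y a : indep x y -> indep x (a *: x + y).
Proof.
move=> xy c d; rewrite scalerDr addrA scalerA -scalerDl => /xy[+ d0].
by rewrite d0 mul0r addr0.
Qed.

End Independence.

Lemma orthogonal_indep {R : realType} {H : complexHilbertType R} (x y : H) :
  x <> 0 -> y <> 0 -> inner y x = 0 -> indep x y.
Proof.
move=> x0 y0 yx; have [//|[a yE]] := indepP y x0.
by case: y0; apply: inner_eq0; rewrite {2}yE innerZr yx mulr0.
Qed.

(** * Unitary and anti-unitary operators *)

Section SemiUnitary.
Context {R : realType} {H : complexHilbertType R}.
Implicit Types (s : R[i] -> R[i]) (U V : H -> H).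

Definition id_or_conj s := (forall a, s a = a) \/ (forall a, s a = a^*).

(** The common form of unitary and anti-unitary operators, except for bijectivity:
    [s] is the identity for the former and the conjugation for the latter. *)
Record semi_unitary s U : Prop := SemiUnitary {
  semi_id_or_conj : id_or_conj s;
  semiD : forall x y, U (x + y) = U x + U y;
  semiZ : forall a x, U (a *: x) = s a *: U x;
  semi_inner : forall x y, inner (U x) (U y) = s (inner x y)
}.

Lemma semi_norm s U x : semi_unitary s U -> inner (U x) (U x) = inner x x.
Proof.
move=> [[sE|sE] _ _ ->]; rewrite sE//.
by rewrite -inner_conj.
Qed.

(** [s] is an involution. *)
Lemma semiK s U a x : semi_unitary s U -> U (s a *: x) = a *: U x.
Proof. by move=> [[sE|sE] _ UZ _]; rewrite UZ !sE// conjCK. Qed.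

Lemma semi0 s U : semi_unitary s U -> U 0 = 0.
Proof. by move=> sU; apply: inner_eq0; rewrite (semi_norm _ sU) inner0l. Qed.

Lemma semi_neq0 s U x : semi_unitary s U -> x <> 0 -> U x <> 0.
Proof.
by move=> sU x0 Ux0; apply/x0/inner_eq0; rewrite -(semi_norm _ sU) Ux0 inner0l.
Qed.

Lemma semi_scale s U a : `|a| = 1 -> semi_unitary s U ->
  semi_unitary s (fun x => a *: U x).
Proof.
move=> a1 [sP UD UZ UI]; split=> //.
- by move=> x y; rewrite UD scalerDr.
- by move=> b x; rewrite UZ !scalerA mulrC.
- by move=> x y; rewrite innerZl innerZr UI mulrA -normCK a1 expr1n mul1r.
Qed.

Lemma unitary_semi U : unitary U \/ antiunitary U -> exists s, semi_unitary s U.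
Proof.
case=> -[_ UL UI].
  have UD x y : U (x + y) = U x + U y by have := UL 1 x y; rewrite !scale1r.
  have U0 : U 0 = 0 by apply: inner_eq0; rewrite UI inner0l.
  exists id; split => //; first by left.
  by move=> a x; have := UL a x 0; rewrite U0 !addr0.
have UD x y : U (x + y) = U x + U y.
  by have := UL 1 x y; rewrite /= conjC1 !scale1r.
have U0 : U 0 = 0 by apply: inner_eq0; rewrite UI inner0l conjC0.
exists Num.conj; split => //; first by right.
by move=> a x; have := UL a x 0; rewrite U0 !addr0.
Qed.

Lemma semi_unitaryP s U : semi_unitary s U -> (forall v, exists x, U x = v) ->
  unitary U \/ antiunitary U.
Proof.
move=> sU /choice[g gK].
have bijU : bijective U.
  exists g => // x; apply: subr0_eq; apply: inner_eq0.
  have UN y : U (- y) = - U y.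
    by apply/eqP; rewrite -addr_eq0 -(semiD sU) addNr (semi0 sU).
  by rewrite -(semi_norm _ sU) (semiD sU) gK UN subrr inner0l.
case: (semi_id_or_conj sU) => sE; [left|right]; split => //.
- by move=> a x y; rewrite (semiD sU) (semiZ sU) sE.
- by move=> x y; rewrite (semi_inner sU) sE.
- by move=> a x y; rewrite (semiD sU) (semiZ sU) sE.
- by move=> x y; rewrite (semi_inner sU) sE.
Qed.

(** Two orthogonal nonzero vectors get the same factor: compare [V (x + y)] with
    [U x + U y].  Any two nonzero vectors are orthogonal to a common third one. *)
Lemma pointwise_multiple_constant s U V : dim_ge H 3 -> semi_unitary s U ->
  (forall x y, V (x + y) = V x + V y) ->
  (forall x, exists c, V x = c *: U x) ->
  exists a, forall x, V x = a *: U x.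
Proof.
move=> dimH sU VD /choice[c Vc].
have orth_c x y : x <> 0 -> y <> 0 -> inner y x = 0 -> c x = c y.
  move=> x0 y0 yx; have indepU : indep (U x) (U y).
    apply: orthogonal_indep; [exact: semi_neq0 sU x0|exact: semi_neq0 sU y0|].
    by rewrite (semi_inner sU) yx; case: (semi_id_or_conj sU) => ->; rewrite ?conjC0.
  have := VD x y; rewrite !Vc (semiD sU) scalerDr.
  by move=> /(indep_coef indepU)[<- <-].
have [e e0 _] := exists_orthogonal (0 : H) 0 dimH.
exists (c e) => x; have [->|/eqP x0] := eqVneq x 0.
  by rewrite Vc (semi0 sU) !scaler0.
have [w w0 [we wx]] := exists_orthogonal e x dimH.
by rewrite Vc (orth_c x w)// -(orth_c e w).
Qed.

End SemiUnitary.

(** * From a correspondence of lines to a semilinear isometry *)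

Section Coordinatization.
Context {R : realType} {H : complexHilbertType R}.
Hypothesis dimH : dim_ge H 3.
Variables (M : H -> H -> Prop) (corrM : line_correspondence M).
Variables (e e' : H).
Hypotheses (e1 : inner e e = 1) (e'1 : inner e' e' = 1) (Mee' : M e e').

Implicit Types (x y z v w : H) (a b c : R[i]).

Let e0 : e <> 0 := unit_neq0 e1.

Let e'0 : e' <> 0 := unit_neq0 e'1.

Lemma corr_indep y z v w : indep y z -> M y v -> M z w -> v <> 0 -> w <> 0 ->
  indep v w.
Proof.
move=> yz Mv Mw v0 w0; have [//|[a wv]] := indepP w v0.
have Myw : M y w by rewrite wv; exact: corrZ.
by have [b /(indepN yz)] := corr_inj corrM Myw Mw w0.
Qed.

Lemma inner_affine y z : inner y e = 0 -> inner z e = 0 ->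
  inner (e + y) (e + z) = 1 + inner y z.
Proof.
move=> ye ze; rewrite innerDl !innerDr e1 ye [inner e z]inner_eq0C//.
by rewrite addr0 add0r.
Qed.

(** The image of the line of [e + y] lies in the plane of [e'] and of the image of
    [y]; its component along [e'] is nonzero, since [e + y] is not on the line of
    [y], so a generator can be scaled to have the form [e' + s]. *)
Lemma shift_ex y : inner y e = 0 -> exists s, M y s /\ M (e + y) (e' + s).
Proof.
move=> ye; have [->|/eqP y0] := eqVneq y 0.
  by exists 0; rewrite !addr0; split => //; exact: corr0.
have [v v0 Mv] := corr_neq0 corrM y0.
have ey0 : e + y <> 0.
  move=> ey0; apply: e0; apply: inner_eq0.
  by rewrite -{1}(addrK y e) innerBl ey0 inner0l ye subrr.
have [t t0 Mt] := corr_neq0 corrM ey0.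
have [|a [b tE]] := corr_plane corrM (a := 1) (b := 1) (t := t) Mee' Mv e'0 v0.
  by rewrite !scale1r.
have [a0|a0] := eqVneq a 0.
  have Myt : M y t by rewrite tE a0 scale0r add0r; exact: corrZ.
  have [c eyE] := corr_inj corrM Myt Mt t0.
  case: e0; apply: inner_eq0.
  by rewrite -{1}(addrK y e) eyE innerBl innerZl ye mulr0 subrr.
exists ((a^-1 * b) *: v); split; first exact: corrZ.
have -> : e' + (a^-1 * b) *: v = a^-1 *: t.
  by rewrite tE scalerDr !scalerA mulVf// scale1r.
exact: corrZ.
Qed.

(** The map that the correspondence induces in the affine charts [e + _] and
    [e' + _] of the two projective spaces. *)
Definition shift y : H := xget 0 [set s | M y s /\ M (e + y) (e' + s)]%classic.
Local Notation S := shift.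

Lemma shiftP y : inner y e = 0 -> M y (S y) /\ M (e + y) (e' + S y).
Proof. by move=> /shift_ex[s sP]; rewrite /shift; case: xgetP => [t _ //|/(_ s)]. Qed.

Lemma shift_orth y : inner y e = 0 -> inner (S y) e' = 0.
Proof. by move=> ye; have [My _] := shiftP ye; exact: corr_orth My Mee'. Qed.

Lemma shift0 : S 0 = 0.
Proof.
have [M0 _] := shiftP (inner0l e); apply: contrapT => S0.
have Me : M e (S 0).
  by apply: (corr_scale corrM (a := 0)); rewrite scale0r.
have [a /esym/eqP] := corr_inj corrM M0 Me S0.
by rewrite scaler0 => /eqP/esym.
Qed.

Lemma shift_neq0 y : inner y e = 0 -> y <> 0 -> S y <> 0.
Proof.
move=> ye y0 Sy0; have [_] := shiftP ye; rewrite Sy0 addr0 => Me.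
have [a eyE] := corr_inj corrM Mee' Me e'0.
apply: y0; have := congr1 (inner^~ e) eyE.
rewrite innerDl innerZl ye e1 addr0 mulr1 => a1.
by move: eyE; rewrite -a1 scale1r -[RHS]addr0 => /addrI.
Qed.

Let orthD y z : inner y e = 0 -> inner z e = 0 -> inner (y + z) e = 0.
Proof. by move=> ye ze; rewrite innerDl ye ze addr0. Qed.

Let orthZ a y : inner y e = 0 -> inner (a *: y) e = 0.
Proof. by move=> ye; rewrite innerZl ye mulr0. Qed.

Lemma shift_indep y z : inner y e = 0 -> inner z e = 0 -> indep y z ->
  indep (S y) (S z).
Proof.
move=> ye ze yz; have [My _] := shiftP ye; have [Mz _] := shiftP ze.
apply: (corr_indep yz My Mz); apply: shift_neq0 => //; first exact: indep_neq0 yz.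
exact: indep_neq0 (indepC yz).
Qed.

(** [e + y + z] is in the plane of [e + y] and [z], so [S (y + z) - S y] is a
    multiple of [S z]; symmetrically [S (y + z) - S z] is a multiple of [S y].
    Independence of [S y] and [S z] makes both factors 1. *)
Lemma shiftD_indep y z : inner y e = 0 -> inner z e = 0 -> indep y z ->
  S (y + z) = S y + S z.
Proof.
have half u v : inner u e = 0 -> inner v e = 0 -> v <> 0 ->
    exists b, S (u + v) = S u + b *: S v.
  move=> ue ve v0.
  have [_ Mu] := shiftP ue; have [Mv _] := shiftP ve.
  have [_ Muv] := shiftP (orthD ue ve).
  have eu0 : e' + S u <> 0.
    move=> eu0; apply: e'0; apply: inner_eq0.
    by rewrite -{1}(addrK (S u) e') innerBl eu0 inner0l shift_orth// subrr.
  have [||a [b E]] := corr_plane corrM (a := 1) (b := 1)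
    (t := e' + S (u + v)) Mu Mv eu0.
  - exact: shift_neq0.
  - by rewrite !scale1r -addrA.
  exists b; have a1 : 1 = a.
    have := congr1 (inner^~ e') E.
    rewrite !(innerDl, innerZl) e'1 !shift_orth//; last exact: orthD.
    by rewrite !addr0 mulr0 addr0 mulr1.
  by move: E; rewrite -a1 scale1r -addrA => /addrI.
move=> ye ze yz; have [|b E] := half y z ye ze; first exact: indep_neq0 (indepC yz).
have [|c] := half z y ze ye; first exact: indep_neq0 yz.
move=> E'; have : 1 *: S y + b *: S z = c *: S y + 1 *: S z.
  by rewrite !scale1r -E [y + z]addrC E' addrC.
by move=> /(indep_coef (shift_indep ye ze yz))[_ b1]; rewrite E b1 scale1r.
Qed.

Lemma shiftZ_ex a y : inner y e = 0 -> exists c, S (a *: y) = c *: S y.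
Proof.
move=> ye; have [->|/eqP y0] := eqVneq y 0.
  by exists 0; rewrite scaler0 shift0 scaler0.
have [My _] := shiftP ye; have [May _] := shiftP (orthZ a ye).
exact: (corr_dim1 corrM My (corr_scale corrM May) (shift_neq0 ye y0)).
Qed.

(** Apply additivity to [a *: y + a *: z = a *: (y + z)]. *)
Lemma shiftZ_indep a b c y z : inner y e = 0 -> inner z e = 0 -> indep y z ->
  S (a *: y) = b *: S y -> S (a *: z) = c *: S z -> b = c.
Proof.
move=> ye ze yz; have [->|a0] := eqVneq a 0.
  have Sy0 := shift_neq0 ye (indep_neq0 yz).
  have Sz0 := shift_neq0 ze (indep_neq0 (indepC yz)).
  rewrite !scale0r shift0 => /esym/eqP; rewrite scaler_eq0 => /orP[/eqP->|/eqP//].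
  by move=> /esym/eqP; rewrite scaler_eq0 => /orP[/eqP->|/eqP//].
move=> Sy Sz; have [d] := shiftZ_ex a (orthD ye ze).
rewrite scalerDr (shiftD_indep (orthZ a ye) (orthZ a ze) (indepZ a0 a0 yz)).
rewrite shiftD_indep// Sy Sz scalerDr => /(indep_coef (shift_indep ye ze yz)).
by move=> [-> ->].
Qed.

Variable u : H.
Hypotheses (u1 : inner u u = 1) (ue : inner u e = 0).

Let u0 : u <> 0 := unit_neq0 u1.

(** The factor by which [S] rescales multiples of [u], and, by [shiftZ] below, of
    every vector orthogonal to [e]. *)
Definition scalar_map a : R[i] := xget 0 [set c | S (a *: u) = c *: S u]%classic.
Local Notation sg := scalar_map.

Let scalar_mapP a : S (a *: u) = sg a *: S u.
Proof. by have [c cP] := shiftZ_ex a ue; rewrite /sg; case: xgetP => [t _ //|/(_ c)]. Qed.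

Let orth_indep y : inner y e = 0 -> y <> 0 ->
  exists2 w, inner w e = 0 & indep y w.
Proof.
move=> ye y0; have [w w0 [we wy]] := exists_orthogonal e y dimH.
by exists w => //; exact: orthogonal_indep.
Qed.

Lemma shiftZ a y : inner y e = 0 -> S (a *: y) = sg a *: S y.
Proof.
move=> ye; have [->|/eqP y0] := eqVneq y 0; first by rewrite scaler0 shift0 scaler0.
have [c Sc] := shiftZ_ex a ye; rewrite Sc; congr (_ *: _).
have [uy|[b yu]] := indepP y u0.
  by apply/esym; apply: shiftZ_indep uy _ Sc => //; exact: scalar_mapP.
(* [y] is a multiple of [u]: compare both with a third direction. *)
have [w we uw] := orth_indep ue u0.
have [d Sd] := shiftZ_ex a we.
have b0 : b != 0 by apply/eqP => b0; apply: y0; rewrite yu b0 scale0r.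
have yw : indep y w.
  by rewrite yu -(scale1r w); apply: indepZ => //; exact: oner_neq0.
rewrite (shiftZ_indep ye we yw Sc Sd).
exact/esym/(shiftZ_indep ue we uw (scalar_mapP a) Sd).
Qed.

Let Su0 : S u <> 0. Proof. exact: shift_neq0. Qed.

Let scaleS a b : a *: S u = b *: S u -> a = b.
Proof.
move=> /eqP; rewrite -subr_eq0 -scalerBl scaler_eq0 subr_eq0 => /orP[/eqP//|/eqP//].
Qed.

Lemma scalar_map1 : sg 1 = 1.
Proof. by apply: scaleS; rewrite -scalar_mapP !scale1r. Qed.

Lemma scalar_map0 : sg 0 = 0.
Proof. by apply: scaleS; rewrite -scalar_mapP !scale0r shift0. Qed.

Lemma scalar_mapM a b : sg (a * b) = sg a * sg b.
Proof.
by apply: scaleS; rewrite -scalar_mapP -scalerA shiftZ ?orthZ// shiftZ// scalerA.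
Qed.

(** An auxiliary independent [w] makes [a *: u] and [b *: u + w] independent, so
    that the additivity of [S] applies to them. *)
Lemma scalar_mapD a b : sg (a + b) = sg a + sg b.
Proof.
have [->|b0] := eqVneq b 0; first by rewrite scalar_map0 !addr0.
have [->|a0] := eqVneq a 0; first by rewrite scalar_map0 !add0r.
have [w we uw] := orth_indep ue u0.
have uw' c : c != 0 -> indep (c *: u) w.
  by move=> c0; rewrite -(scale1r w); apply: indepZ => //; exact: oner_neq0.
have D c : S (c *: u + w) = sg c *: S u + S w.
  have [->|c0] := eqVneq c 0; first by rewrite scalar_map0 !scale0r !add0r.
  by rewrite (shiftD_indep (orthZ c ue) we (uw' _ c0)) shiftZ.
have : S ((a + b) *: u + w) = S (a *: u) + S (b *: u + w).
  rewrite -shiftD_indep ?orthZ//.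
  - by rewrite scalerDl addrA.
  - by apply: orthD => //; exact: orthZ.
  have := indep_shear (a := b / a) (uw' _ a0).
  by rewrite scalerA divfK.
rewrite !D shiftZ// addrA => /addIr; rewrite -scalerDl.
exact: scaleS.
Qed.

Lemma shiftD y z : inner y e = 0 -> inner z e = 0 -> S (y + z) = S y + S z.
Proof.
move=> ye ze; have [->|/eqP y0] := eqVneq y 0; first by rewrite shift0 !add0r.
have [yz|[a ->]] := indepP z y0; first exact: shiftD_indep.
by rewrite -{1}(scale1r y) -scalerDl !shiftZ// scalar_mapD scalar_map1 scalerDl scale1r.
Qed.

Let sgN1 : sg (- 1) = - 1.
Proof.
by apply/eqP; rewrite -addr_eq0 -{2}scalar_map1 -scalar_mapD addNr scalar_map0.
Qed.

Let conj_oppV a : (- (a^*)^-1)^* = - a^-1.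
Proof. by rewrite rmorphN fmorphV /= conjCK. Qed.

(** [inner y z = -1] says that [e + y] and [e + z] are orthogonal. *)
Lemma inner_shiftN1 y z : inner y e = 0 -> inner z e = 0 -> inner y z = - 1 ->
  inner (S y) (S z) = - 1.
Proof.
move=> ye ze yz; have [_ My] := shiftP ye; have [_ Mz] := shiftP ze.
have := corr_orth corrM _ My Mz; rewrite inner_affine// yz subrr => /(_ erefl).
rewrite innerDl !innerDr e'1 (shift_orth ye) [inner e' _]inner_eq0C ?shift_orth//.
by rewrite addr0 add0r => /eqP; rewrite addrC addr_eq0 => /eqP.
Qed.

(** If [a * b^* = -1] then [a *: u] and [b *: u] have inner product [-1], hence so
    do their images, which are multiples of the unit vector [S u]. *)
Lemma scalar_map_conj a : sg a^* = (sg a)^*.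
Proof.
have SuSu : inner (S u) (S u) = 1.
  have : inner (S u) (S (- 1 *: u)) = - 1.
    by apply: inner_shiftN1; rewrite ?orthZ// innerZr u1 rmorphN1 mulr1.
  by rewrite shiftZ// sgN1 innerZr rmorphN1 mulN1r => /oppr_inj.
have [->|a0] := eqVneq a 0; first by rewrite conjC0 scalar_map0 conjC0.
pose b := - (a^*)^-1.
have : inner (S (a *: u)) (S (b *: u)) = - 1.
  apply: inner_shiftN1; rewrite ?orthZ// innerZl innerZr u1 mulr1.
  by rewrite conj_oppV mulrN mulfV.
rewrite !shiftZ// innerZl innerZr SuSu mulr1 => /(congr1 (@Num.conj R[i])).
rewrite rmorphM/= conjCK rmorphN1 => sasb.
have : sg a^* * sg b = - 1.
  by rewrite -scalar_mapM mulrN mulfV// conjC_eq0.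
rewrite -sasb; apply: mulIf; apply/eqP => sb0.
by move/eqP: sasb; rewrite sb0 mulr0 eq_sym oppr_eq0 oner_eq0.
Qed.

(** Scale [z] so that the inner product becomes [-1]. *)
Lemma inner_shift y z : inner y e = 0 -> inner z e = 0 ->
  inner (S y) (S z) = sg (inner y z).
Proof.
move=> ye ze; have [yz|yz] := eqVneq (inner y z) 0.
  rewrite yz scalar_map0; have [My _] := shiftP ye; have [Mz _] := shiftP ze.
  exact: corr_orth My Mz.
pose b := - ((inner y z)^*)^-1.
have : inner (S y) (S (b *: z)) = - 1.
  apply: inner_shiftN1; rewrite ?orthZ// innerZr.
  by rewrite conj_oppV mulNr mulVf.
rewrite shiftZ// innerZr -scalar_map_conj => sb.
have : sg b^* * sg (inner y z) = - 1.
  by rewrite -scalar_mapM conj_oppV mulNr mulVf.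
rewrite -sb => /esym; apply: mulfI; apply/eqP => sb0.
by move/eqP: sb; rewrite sb0 mul0r eq_sym oppr_eq0 oner_eq0.
Qed.

Definition semilinear_extension x : H :=
  sg (inner x e) *: e' + S (x - inner x e *: e).
Local Notation U := semilinear_extension.

Let orth_part x : inner (x - inner x e *: e) e = 0.
Proof. by rewrite innerBl innerZl e1 mulr1 subrr. Qed.

Lemma extensionD x y : U (x + y) = U x + U y.
Proof.
rewrite [RHS]addrACA -scalerDl -scalar_mapD -innerDl -shiftD//.
by rewrite [in RHS]addrACA -opprD -scalerDl -innerDl.
Qed.

Lemma extensionZ a x : U (a *: x) = sg a *: U x.
Proof.
by rewrite /U innerZl scalar_mapM -!scalerA -scalerBr shiftZ// scalerDr.
Qed.

Lemma inner_extension x y : inner (U x) (U y) = sg (inner x y).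
Proof.
pose x' := x - inner x e *: e; pose y' := y - inner y e *: e.
have x'e : inner x' e = 0 by exact: orth_part.
have y'e : inner y' e = 0 by exact: orth_part.
have -> : inner x y = inner x e * (inner y e)^* + inner x' y'.
  rewrite -{1}(subrK (inner x e *: e) x) -{1}(subrK (inner y e *: e) y) -/x' -/y'.
  clearbody x' y'; rewrite innerDl !innerDr !innerZl !innerZr e1 x'e (inner_eq0C y'e).
  by rewrite !mulr0 addr0 add0r mulr1 addrC.
rewrite scalar_mapD scalar_mapM scalar_map_conj -(inner_shift x'e y'e) /U -/x' -/y'.
rewrite innerDl !innerDr !innerZl !innerZr e'1 shift_orth//.
by rewrite (inner_eq0C (shift_orth y'e)) !mulr0 addr0 add0r mulr1.
Qed.

Lemma extension_corr x : M x (U x).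
Proof.
rewrite /U; set y := x - _; set a := inner x e.
have [My _] := shiftP (orth_part x).
have [a0|a0] := eqVneq a 0.
  rewrite a0 scalar_map0 scale0r add0r.
  by move: My; rewrite /y -/a a0 scale0r subr0.
have xE : e + a^-1 *: y = a^-1 *: x.
  by rewrite /y scalerBr scalerA -/a mulVf// scale1r addrC subrK.
have [_] := shiftP (orthZ a^-1 (orth_part x)); rewrite -/y xE => /(corr_scale corrM) Mx.
suff -> : sg a *: e' + S y = sg a *: (e' + S (a^-1 *: y)) by exact: corrZ.
by rewrite scalerDr -shiftZ ?orthZ ?(orth_part x)// scalerA mulfV// scale1r.
Qed.

Lemma scalar_map_id_or_conj : id_or_conj sg.
Proof.
have sB : zmod_morphism sg.
  by move=> a b; rewrite scalar_mapD -mulN1r scalar_mapM sgN1 mulN1r.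
have sM : monoid_morphism sg by split; [exact: scalar_map1|exact: scalar_mapM].
pose s : {rmorphism R[i] -> R[i]} := HB.pack sg
  (GRing.isZmodMorphism.Build _ _ sg sB) (GRing.isMonoidMorphism.Build _ _ sg sM).
exact: (@conj_endoP _ s scalar_map_conj).
Qed.

End Coordinatization.

(** Uhlhorn's theorem, for lines. *)
Theorem line_correspondence_induced {R : realType} {H : complexHilbertType R}
    (M : H -> H -> Prop) : dim_ge H 3 -> line_correspondence M ->
  exists (s : R[i] -> R[i]) (U : H -> H), semi_unitary s U /\ forall x, M x (U x).
Proof.
move=> dimH corrM.
have [x x0 _] := exists_orthogonal (0 : H) 0 dimH.
have [a a0 e1] := exists_unit_multiple x0; set e := a *: x in e1.
have [v v0 Mv] := corr_neq0 corrM (unit_neq0 e1).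
have [b b0 e'1] := exists_unit_multiple v0.
have Me := corrZ corrM b Mv.
have [y y0 [ye _]] := exists_orthogonal e e dimH.
have [c c0 u1] := exists_unit_multiple y0.
have ue : inner (c *: y) e = 0 by rewrite innerZl ye mulr0.
exists (scalar_map M e (b *: v) (c *: y)).
exists (semilinear_extension M e (b *: v) (c *: y)).
split; last exact: extension_corr.
split.
- exact: scalar_map_id_or_conj.
- exact: extensionD.
- exact: extensionZ.
- exact: inner_extension.
Qed.

(** * The theorem *)

Theorem theorem3p1 (R : realType) (H : complexHilbertType R)
    (dimH : dim_ge H 3)
    (f : closed_subspace H -> closed_subspace H)
    (hf : logic_automorphism f) :
  exists U : H -> H,
    induced_by f U /\
    forall V : H -> H,
      induced_by f V <->
      exists a : R[i], `|a| = 1 /\ forall x, V x = a *: U x.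
Proof.
have corrM := image_line_correspondence hf.
have [s [U [sU UM]]] := line_correspondence_induced dimH corrM.
have U_surj v : exists x, U x = v.
  have [->|/eqP v0] := eqVneq v 0; first by exists 0; exact: semi0 sU.
  have [x Mv] := corr_surj corrM v.
  have x0 : x <> 0 by move=> x0; apply: v0; exact: (image_line0 hf Mv x0).
  have [a ->] := corr_dim1 corrM (UM x) Mv (semi_neq0 sU x0).
  by exists (s a *: x); exact: (semiK _ _ sU).
have fE (X : closed_subspace H) : subspace_set (f X) = (U @` X)%classic.
  apply/seteqP; split => [v Xv|_ [x Xx <-]]; last first.
    exact: (image_line_mem hf (UM x) Xx).
  have [v0|/eqP v0] := eqVneq v 0.
    by exists 0; [exact: subspace0|rewrite v0; exact: semi0 sU].
  have [x Ux] := U_surj v; exists x => //.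
  by apply: (image_line_in hf _ v0 Xv); rewrite -Ux.
exists U; split; first by split => //; exact: semi_unitaryP sU U_surj.
move=> V; split => [[Vunit VE]|[a [a1 VU]]].
  have [t tV] := unitary_semi Vunit.
  have [|a VU] := pointwise_multiple_constant (V := V) dimH sU (semiD tV).
    move=> x; have [->|/eqP x0] := eqVneq x 0.
      by exists 0; rewrite (semi0 tV) scale0r.
    apply: (corr_dim1 corrM (UM x) _ (semi_neq0 sU x0)).
    by rewrite /image_line VE; exists x => //; exact: line_self.
  exists a; split => //.
  (* The modulus of [a] is read off the norms of [U x] and [V x] for some [x]. *)
  have [x x0 _] := exists_orthogonal (0 : H) 0 dimH.
  apply/eqP; rewrite -sqrp_eq1// normCK; apply/eqP.
  apply: (mulIf (inner_neq0 x0)).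
  by rewrite mul1r -[RHS](semi_norm x tV) VU innerZl innerZr mulrA (semi_norm x sU).
have {VU}-> : V = (fun x => a *: U x) by apply/funext.
have a0 : a != 0 by rewrite -normr_eq0 a1 oner_neq0.
have aU := semi_scale a1 sU; split.
  apply: semi_unitaryP aU _ => v; have [x Ux] := U_surj (a^-1 *: v).
  by exists x; rewrite Ux scalerA mulfV// scale1r.
move=> X; rewrite fE; apply/seteqP; split => _ [x Xx <-].
  exists (s a^-1 *: x); first exact: subspaceZ.
  by rewrite (semiK _ _ sU) scalerA mulfV// scale1r.
by exists (s a *: x); [exact: subspaceZ|rewrite (semiK _ _ sU)].
Qed.
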